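(* Let $g$ be a positive integer. If $\mathcal{A}$ is a $g$-Golomb ruler with counting function $A(n) = |\mathcal{A}\cap[0,n)|$, then $$\liminf_{n\to\infty} \frac{A(n)}{\sqrt{n/\log n}} \le \frac{2}{\sqrt{\log 2}}\,\sqrt{g}.$$
   Context: For a positive integer $g$, a set $\mathcal{A}$ of nonnegative integers (finite or infinite) is a $g$-Golomb ruler if for each integer $d>0$ there are at most $g$ pairs $(a,b)\in\mathcal{A}\times\mathcal{A}$ with $d=a-b$. Here $\log$ is the natural logarithm, and $n$ runs through positive integers. *)

(* Defs.v *)
From mathcomp Require Import all_boot all_order all_algebra finmap.
From mathcomp Require Import boolp classical_sets functions cardinality.
From mathcomp Require Import reals ereal topology normedtype sequences exp.

Set Implicit Arguments.
Unset Strict Implicit.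
Unset Printing Implicit Defensive.

Import Order.TTheory GRing.Theory Num.Theory.

Local Open Scope classical_set_scope.
Local Open Scope card_scope.
Local Open Scope ring_scope.

(* The difference is taken in int, since subtraction on nat is truncated. *)
Definition golomb_ruler (g : nat) (A : set nat) : Prop :=
  forall d : int, 0 < d ->
    [set p : nat * nat | [/\ A p.1, A p.2 & d = p.1%:Z - p.2%:Z]] #<= `I_g.

(* fset_set sends a finite set to the corresponding fset, and A `&` `I_n is
   always finite, so this is its true cardinality even when A is infinite. *)
Definition counting (A : set nat) (n : nat) : nat :=
  #|` fset_set (A `&` `I_n) |%fset.

(* Main.v *)
Require Import Defs.
From mathcomp Require Import all_boot all_order all_algebra finmap.
From mathcomp Require Import boolp classical_sets functions cardinality.
From mathcomp Require Import reals ereal topology normedtype sequences exp.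
From mathcomp Require Import zify ring lra.

(** Write A(n) for the counting function of a g-Golomb ruler A, and suppose that
    c sqrt(n / ln n) <= A(n) for all large n; the claim amounts to
    c^2 ln 2 <= 4 g.

    Slide a window of length u along the integers, and let D(x) be the number
    of a in A with a <= x < a + u. A pair of elements of A at distance d lies
    in at most u - d common windows, and each d > 0 occurs at most g times, so
    the squares D(x)^2 add up to at most g u^2 plus the sum of the D(x)
    ([sum_window_sqr]). Averaging over all positions of the window, rather than
    cutting the line into disjoint blocks, saves a factor 2 here.

    On the other hand, u A(n) is at most the sum of D(x) over x < n + u
    ([sum_window_ge]). Multiply this by n^(-3/2) (ln n)^(-1/2) and sum over
    u <= n < X. The hypothesis bounds the left side below by u c S, where S is
    the sum of 1 / (n ln n) over u <= n < X. Exchanging the order of summation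
    on the right side makes D(y + u) appear with a coefficient at most
    2 / sqrt(y ln y), and the squares of these bounds add up to 4 S. The
    inequality of arithmetic and geometric means then gives
    c^2 S <= 4 (g + A(X + u) / u) + O(1 / sqrt(ln u))
    ([weighted_window_bound]); the error term comes from the x < 2 u.

    Since A(n) = O(sqrt(g n)) ([count_below_le_sqrt]), the choice u = k^2 v and
    X = k^2 v^2 makes A(X + u) / u = O(g / k), while S is at least
    ln (ln X) - ln (ln u), which tends to ln 2 as v grows with k fixed
    ([lnln_sub_ge]). Letting v and then k grow yields c^2 ln 2 <= 4 g
    ([eventual_lower_bound_le]). *)

Set Implicit Arguments.
Unset Strict Implicit.
Unset Printing Implicit Defensive.

Import Order.TTheory GRing.Theory Num.Theory.

Local Open Scope classical_set_scope.
Local Open Scope nat_scope.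

(** * Counting pairs in sliding windows

    A set of natural numbers is handled here through a boolean predicate, so
    that counting becomes summation of booleans coerced to natural numbers. *)

(** The number of elements of the set b that are smaller than n. *)
Definition count_below (b : pred nat) (n : nat) : nat := \sum_(0 <= a < n) b a.

(** Every d > 0 is a difference of two elements of b in at most g ways; the
    bound N keeps the sum finite. *)
Definition sparse_differences (g : nat) (b : pred nat) : Prop :=
  forall d N, 0 < d -> \sum_(0 <= a < N) b a * b (a + d) <= g.

(** The number of a < N in b such that x lies in the interval [a, a + u), that
    is, such that a lies in the window (x - u, x]. The cut-off N only matters
    for x >= N. *)
Definition window (b : pred nat) (u N x : nat) : nat :=
  \sum_(0 <= a < N) b a * (a <= x < a + u).

Lemma leq_sum_range m n (E F : nat -> nat) :
  (forall i, m <= i < n -> E i <= F i) ->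
  \sum_(m <= i < n) E i <= \sum_(m <= i < n) F i.
Proof.
move=> EF; rewrite big_nat [leqRHS]big_nat.
exact: leq_sum.
Qed.

Lemma sum_interval p q M :
  \sum_(0 <= x < M) (p <= x < q : nat) = minn q M - p.
Proof.
elim: M => [|M IH]; first by rewrite big_geq //; lia.
rewrite big_nat_recr //= IH.
by case: (leqP p M); case: (ltnP M q); lia.
Qed.

Lemma sqr_sum (f : nat -> nat) N :
  (\sum_(0 <= a < N) f a) ^ 2 =
  \sum_(0 <= a < N) f a ^ 2
  + 2 * \sum_(0 <= a' < N) \sum_(0 <= a < a') f a * f a'.
Proof.
elim: N => [|N IH]; first by rewrite !big_geq.
rewrite !big_nat_recr //= sqrnD IH -big_distrl /=; lia.
Qed.

(** The pairs a < a' in b are grouped by their distance d; each group has at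
    most g members. *)
Lemma sum_pairs g b (phi : nat -> nat) N : sparse_differences g b ->
  \sum_(0 <= a' < N) \sum_(0 <= a < a') b a * b a' * phi (a' - a)
  <= g * \sum_(1 <= d < N) phi d.
Proof.
move=> hb.
have E a' : a' < N -> \sum_(0 <= a < a') b a * b a' * phi (a' - a) =
    \sum_(1 <= d < N | d <= a') b (a' - d) * b a' * phi d.
  (* The substitution d = a' - a; terms with a' < d < N are filtered out. *)
  move=> ha'; rewrite big_nat_rev /= add0n.
  rewrite [RHS](big_cat_nat (n := a'.+1)) //=.
  rewrite [X in _ = (_ + X)%N]big_nat_cond.
  rewrite [X in _ = (_ + X)%N]big_pred0; last by move=> i; lia.
  rewrite addn0 big_add1 /= big_nat_cond [RHS]big_nat_cond.
  apply: eq_big => i; first by lia.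
  move=> /andP[hi _]; rewrite (_ : a' - (a' - i.+1) = i.+1); last by lia.
  by [].
rewrite [X in X <= _](eq_big_nat _ _ (fun a' ha' => E a' (proj2 (andP ha')))).
rewrite (exchange_big_dep_nat xpredT) //= big_distrr /=.
apply: leq_sum_range => d /andP[d0 _].
rewrite -big_distrl /= leq_mul2r; apply/orP; right.
apply: leq_trans (hb d (N - d) d0).
rewrite -(big_nat_widenl _ 0 N xpredT (fun i => b (i - d) * b i) (leq0n d)).
rewrite -{1}[d]add0n big_addn.
by apply: leq_sum => a _; rewrite addnK.
Qed.

Lemma count_below_sqr g b n : sparse_differences g b ->
  count_below b n ^ 2 <= count_below b n + 2 * (g * n).
Proof.
move=> hb; rewrite {1}/count_below sqr_sum leq_add //.
  by apply: leq_sum => i _; case: (b i).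
rewrite leq_mul2l /=.
have := sum_pairs (fun=> 1) n hb.
under eq_bigr do under eq_bigr do rewrite muln1.
move/leq_trans; apply; rewrite sum_nat_const_nat; nia.
Qed.

Lemma count_below_mono b : {homo count_below b : m n / m <= n}.
Proof.
move=> m n mn; rewrite /count_below [leqRHS](big_cat_nat (n := m)) //=.
exact: leq_addr.
Qed.

(** Each a in b contributes the number of x < M in the interval [a, a + u); the
    truncated difference is 0 when M <= a. *)
Lemma sum_window b u N M : \sum_(0 <= x < M) window b u N x =
  \sum_(0 <= a < N) b a * (minn (a + u) M - a).
Proof.
rewrite exchange_big_nat /=; apply: eq_bigr => a _.
by rewrite -big_distrr /= sum_interval.
Qed.

Lemma sum_window_ge b u N n : n <= N ->
  u * count_below b n <= \sum_(0 <= x < n + u) window b u N x.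
Proof.
move=> nN; rewrite sum_window (big_cat_nat (n := n)) //=.
apply: leq_trans (leq_addr _ _); rewrite big_distrr /=.
by apply: leq_sum_range => a ha; rewrite mulnC leq_mul2l; lia.
Qed.

Lemma sum_window_le b u N M :
  \sum_(0 <= x < M) window b u N x <= u * count_below b (minn M N).
Proof.
rewrite sum_window (big_cat_nat (n := minn M N)) ?geq_minr //=.
rewrite [X in _ + X]big_nat_cond [X in _ + X]big1 ?addn0.
  by rewrite big_distrr /=; apply: leq_sum => a _; rewrite mulnC leq_mul2r; lia.
by move=> a ha; apply/eqP; rewrite muln_eq0; lia.
Qed.

(** Off the diagonal, a < a' share at most u - (a' - a) windows, truncated at 0;
    the diagonal contributes the sum on the right. *)
Lemma sum_window_sqr g b u N M : sparse_differences g b ->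
  \sum_(0 <= x < M) window b u N x ^ 2
  <= g * u ^ 2 + \sum_(0 <= x < M) window b u N x.
Proof.
move=> hb; under eq_bigr do rewrite /window sqr_sum.
rewrite big_split /= addnC leq_add //; last first.
  apply: leq_sum => x _; apply: leq_sum => a _.
  by case: (b a); case: (_ <= x < _).
rewrite -big_distrr /= exchange_big_nat /=.
(* Induction on N needs the remaining triangle of terms u - d with d >= N. *)
have hsum : 2 * \sum_(1 <= d < N) (u - d) <= u ^ 2.
  elim: N => [|N IH]; first by rewrite big_geq.
  have : 2 * \sum_(1 <= d < N.+1) (u - d) + (u - N) * (u - N).-1 <= u ^ 2.
    elim: N {IH} => [|N IH]; first by rewrite big_geq //; nia.
    rewrite big_nat_recr //= mulnDr.
    by move: IH; set s := \sum_(_ <= _ < _) _; nia.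
  by apply: leq_trans; exact: leq_addr.
apply: (@leq_trans (2 * (g * \sum_(1 <= d < N) (u - d)))); last by nia.
rewrite leq_mul2l /=; apply: leq_trans (sum_pairs (fun d => u - d) N hb).
apply: leq_sum => a' _; rewrite exchange_big_nat /=.
apply: leq_sum_range => a ha.
rewrite (eq_bigr (fun x => b a * b a' * (a' <= x < a + u))); last first.
  move=> x _; case: (b a); case: (b a') => //=; rewrite ?mul0n ?muln0 //.
  by rewrite !mul1n mulnb; congr (nat_of_bool _); lia.
by rewrite -big_distrr /= sum_interval leq_mul2l; lia.
Qed.

Local Open Scope ring_scope.

(** * Weights and their sums *)

(** A discrete form of the fact that -2 x^(-1/2) is a primitive of x^(-3/2). *)
Lemma inv_sqrt_diff_ge (R : realType) (n : nat) : (0 < n)%N ->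
  (n.+1%:R * Num.sqrt n.+1%:R)^-1
  <= 2 * ((Num.sqrt n%:R)^-1 - (Num.sqrt n.+1%:R)^-1) :> R.
Proof.
move=> n0.
have p0 : 0 < Num.sqrt n%:R :> R by rewrite sqrtr_gt0 ltr0n.
have q0 : 0 < Num.sqrt n.+1%:R :> R by rewrite sqrtr_gt0 ltr0n.
have p2 : Num.sqrt n%:R ^+ 2 = n%:R :> R by rewrite sqr_sqrtr.
have q2 : Num.sqrt n.+1%:R ^+ 2 = n.+1%:R :> R by rewrite sqr_sqrtr.
have q2p : Num.sqrt n.+1%:R ^+ 2 = Num.sqrt n%:R ^+ 2 + 1 :> R.
  by rewrite p2 q2 -natr1.
rewrite -{1}q2; move: p0 q0 q2p.
set p := Num.sqrt n%:R; set q := Num.sqrt n.+1%:R => p0 q0 q2p.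
have pq : p <= q by rewrite ler_wsqrtr // ler_nat.
have pqV : p^-1 - q^-1 = (q - p) / (p * q) by field; rewrite !gt_eqF.
rewrite pqV -[leLHS]mul1r ler_pdivrMr ?mulr_gt0 ?exprn_gt0 //.
have -> : 2 * ((q - p) / (p * q)) * (q ^+ 2 * q) = 2 * (q - p) * q ^+ 2 / p.
  by field; rewrite !gt_eqF.
rewrite ler_pdivlMr // mul1r.
have e : p = (q - p) * (p * (p + q)).
  by rewrite mulrCA -[LHS]mulr1; congr (_ * _); lra.
rewrite {1}e -[leRHS]mulrA [leRHS]mulrCA ler_wpM2l ?subr_ge0 //; nra.
Qed.

(** The weight 1 / sqrt(n ln n); weight n / n is the coefficient
    n^(-3/2) (ln n)^(-1/2) by which the bounds on the counting function are
    averaged. *)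
Definition weight (R : realType) (n : nat) : R :=
  (Num.sqrt (n%:R * ln n%:R))^-1.

Lemma ln_nat_gt0 (R : realType) (n : nat) : (1 < n)%N -> 0 < ln n%:R :> R.
Proof. by move=> n1; rewrite ln_gt0 // ltr1n. Qed.

Lemma weight_ge0 (R : realType) (n : nat) : 0 <= weight R n.
Proof. by rewrite invr_ge0 sqrtr_ge0. Qed.

Lemma weight_sqr (R : realType) (n : nat) : (1 < n)%N ->
  weight R n ^+ 2 = (n%:R * ln n%:R)^-1.
Proof.
by move=> n1; rewrite /weight exprVn sqr_sqrtr // mulr_ge0 // ltW // ln_nat_gt0.
Qed.

Lemma sum_weight_div_lt (R : realType) (y X : nat) : (1 < y)%N ->
  \sum_(y.+1 <= n < X) weight R n / n%:R <= 2 * weight R y.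
Proof.
move=> y1; have ly := ln_nat_gt0 R y1.
have sly : 0 < Num.sqrt (ln y%:R) :> R by rewrite sqrtr_gt0.
have y0 : (0 < y)%N by lia.
(* For n > y, bound ln n below by ln y; the remaining sum telescopes. *)
suff H k : \sum_(y.+1 <= n < y.+1 + k) weight R n / n%:R <=
    2 * (Num.sqrt (ln y%:R))^-1
      * ((Num.sqrt y%:R)^-1 - (Num.sqrt (y + k)%:R)^-1).
  have [Xy|yX] := leqP X y.+1.
    by rewrite big_geq // mulr_ge0 ?weight_ge0.
  rewrite -(subnKC (ltnW yX)); apply: le_trans (H _) _.
  rewrite /weight [Num.sqrt (y%:R * _)]sqrtrM // invfM.
  have : 0 <= (Num.sqrt (ln y%:R))^-1 * (Num.sqrt (y + (X - y.+1))%:R)^-1 :> R.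
    by rewrite mulr_ge0 ?invr_ge0 ?sqrtr_ge0.
  lra.
elim: k => [|k IH]; first by rewrite addn0 big_geq // addn0 subrr mulr0.
rewrite addnS big_nat_recr /=; last by lia.
have st : weight R (y.+1 + k) / (y.+1 + k)%:R <= 2 * (Num.sqrt (ln y%:R))^-1 *
   ((Num.sqrt (y + k)%:R)^-1 - (Num.sqrt (y + k).+1%:R)^-1).
  have h : (Num.sqrt (ln (y + k).+1%:R))^-1 <= (Num.sqrt (ln y%:R))^-1 :> R.
    rewrite lef_pV2 ?posrE // ?sqrtr_gt0 ?ln_nat_gt0 //; last lia.
    rewrite ler_wsqrtr // ler_ln ?posrE ?ltr0n // ler_nat; lia.
  have pos : 0 <= ((y + k).+1%:R * Num.sqrt (y + k).+1%:R)^-1 :> R.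
    by rewrite invr_ge0 mulr_ge0 ?sqrtr_ge0.
  rewrite addSn.
  have sd : ((y + k).+1%:R * Num.sqrt (y + k).+1%:R)^-1 <=
      2 * ((Num.sqrt (y + k)%:R)^-1 - (Num.sqrt (y + k).+1%:R)^-1) :> R.
    by apply: inv_sqrt_diff_ge; lia.
  have -> : weight R (y + k).+1 / (y + k).+1%:R =
      (Num.sqrt (ln (y + k).+1%:R))^-1
        * ((y + k).+1%:R * Num.sqrt (y + k).+1%:R)^-1.
    by rewrite /weight sqrtrM // !invfM; ring.
  apply: le_trans (ler_wpM2r pos h) _.
  apply: le_trans (ler_wpM2l _ sd) _; first by rewrite invr_ge0 sqrtr_ge0.
  by rewrite mulrCA mulrA.
rewrite addnS; move: IH st; lra.
Qed.

Lemma sum_weight_div_le (R : realType) (u X : nat) : (1 < u)%N ->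
  \sum_(u <= n < X) weight R n / n%:R <= 3 * weight R u.
Proof.
move=> u1; have [Xu|uX] := leqP X u.
  by rewrite big_geq // mulr_ge0 ?weight_ge0.
rewrite big_ltn //.
have h : weight R u / u%:R <= weight R u.
  rewrite ler_piMr ?weight_ge0 // invf_le1 ?ler1n ?ltr0n; lia.
by have := sum_weight_div_lt R X u1; lra.
Qed.

(** The sum of 1 / (n ln n) compared with its primitive ln (ln x), by applying
    ln (1 + t) <= t twice. *)
Lemma sum_inv_nln_ge (R : realType) (u X : nat) : (1 < u <= X)%N ->
  ln (ln X%:R) - ln (ln u%:R) <= \sum_(u <= n < X) (n%:R * ln n%:R)^-1 :> R.
Proof.
move=> /andP[u1 uX].
rewrite -(telescope_sumr (fun n => ln (ln n%:R)) uX).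
rewrite big_nat [leRHS]big_nat; apply: ler_sum => n /andP[un _].
have n1 : (1 < n)%N by lia.
have l0 := ln_nat_gt0 R n1; have l1 := ln_nat_gt0 R (ltnW n1 : (1 < n.+1)%N).
have n0 : 0 < n%:R :> R by rewrite ltr0n; lia.
rewrite -ln_div ?posrE //.
have -> : ln n.+1%:R / ln n%:R = 1 + (ln n.+1%:R - ln n%:R) / ln n%:R :> R.
  by rewrite mulrBl divff ?gt_eqF // addrC subrK.
have h : ln n.+1%:R - ln n%:R <= n%:R^-1 :> R.
  rewrite -ln_div ?posrE ?ltr0n //; last lia.
  have -> : n.+1%:R / n%:R = 1 + n%:R^-1 :> R.
    by rewrite -natr1 mulrDl divff ?gt_eqF // mul1r.
  by rewrite le_ln1Dx // (lt_trans (ltrN10 _)) // invr_gt0.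
have h0 : 0 <= ln n.+1%:R - ln n%:R :> R.
  by rewrite subr_ge0 ler_ln ?posrE ?ltr0n // ?ler_nat; lia.
apply: le_trans (le_ln1Dx _) _.
  by rewrite (lt_le_trans (ltrN10 _)) // divr_ge0 // ltW.
by rewrite invfM ler_pM2r ?invr_gt0.
Qed.

(** * The averaged inequality *)

(** Exchange of the summations over n and x. For x < 2 u the full sum of the
    weights is used, for x = y + u with u <= y only the terms n > y. *)
Lemma sum_window_weighted (R : realType) (b : pred nat) (u X N : nat) :
  (1 < u)%N ->
  \sum_(u <= n < X) weight R n / n%:R
     * \sum_(0 <= x < n + u) (window b u N x)%:R
  <= 3 * weight R u * (u%:R * (count_below b (2 * u))%:R)
     + \sum_(u <= y < X) 2 * weight R y * (window b u N (y + u))%:R.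
Proof.
move=> u1.
have -> : \sum_(u <= n < X) weight R n / n%:R
     * \sum_(0 <= x < n + u) (window b u N x)%:R =
   \sum_(u <= n < X) weight R n / n%:R
     * \sum_(0 <= x < 2 * u) (window b u N x)%:R +
   \sum_(u <= n < X) \sum_(u <= y < X | (y < n)%N)
     weight R n / n%:R * (window b u N (y + u))%:R.
  rewrite -big_split /=; apply: eq_big_nat => n /andP[un nX].
  rewrite (big_cat_nat (n := (2 * u)%N)) //=; last lia.
  rewrite mulrDr; congr (_ + _).
  rewrite -(big_nat_widen _ _ _ xpredT) ?(ltnW nX) // -big_distrr /=.
  congr (_ * _).
  rewrite (_ : 2 * u = u + u)%N; last lia.
  by rewrite big_addn addnK.
apply: lerD.
  rewrite -big_distrl /= ler_pM ?sum_weight_div_le ?sumr_ge0 //.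
    by move=> n _; rewrite divr_ge0 ?weight_ge0.
  rewrite -natr_sum -natrM ler_nat.
  apply: leq_trans (sum_window_le _ _ _ _) _.
  by rewrite leq_mul2l count_below_mono ?geq_minl ?orbT.
rewrite (exchange_big_dep_nat xpredT) //=.
rewrite big_nat [leRHS]big_nat; apply: ler_sum => y /andP[uy yX].
rewrite -(big_nat_widenl _ u X xpredT) /=; last lia.
rewrite -big_distrl /= ler_wpM2r // sum_weight_div_lt //; lia.
Qed.

(** [lower] and [sum_window_weighted] bound the averaged counting function from
    both sides, and [squares] is the bound on the window counts. *)
Lemma weighted_window_bound (R : realType) (g : nat) (b : pred nat)
    (c : R) (u X : nat) :
  sparse_differences g b -> 0 < c -> (1 < u)%N ->
  (forall n, (u <= n < X)%N ->
     c * Num.sqrt (n%:R / ln n%:R) <= (count_below b n)%:R) ->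
  c ^+ 2 * \sum_(u <= n < X) (n%:R * ln n%:R)^-1
  <= 6 * c * (weight R u * (count_below b (2 * u))%:R)
     + 4 * (g%:R + (count_below b (X + u))%:R / u%:R).
Proof.
move=> hb c0 u1 hc.
set S := \sum_(u <= n < X) _.
pose N := (X + u)%N.
have u0 : 0 < u%:R :> R by rewrite ltr0n; lia.
have lower : u%:R * c * S <=
    \sum_(u <= n < X) weight R n / n%:R
      * \sum_(0 <= x < n + u) (window b u N x)%:R.
  rewrite /S big_distrr /= big_nat [leRHS]big_nat.
  apply: ler_sum => n /andP[un nX].
  have n1 : (1 < n)%N by lia.
  have n0 : 0 < n%:R :> R by rewrite ltr0n; lia.
  have l0 := ln_nat_gt0 R n1.
  have sl0 : 0 < Num.sqrt (ln n%:R) :> R by rewrite sqrtr_gt0.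
  have sn0 : 0 < Num.sqrt (n%:R) :> R by rewrite sqrtr_gt0.
  have -> : u%:R * c * (n%:R * ln n%:R)^-1 =
      weight R n / n%:R * (u%:R * (c * Num.sqrt (n%:R / ln n%:R))).
    rewrite /weight !sqrtrM // ?sqrtrV ?ltW // -{1}(sqr_sqrtr (ltW l0)).
    by field; rewrite !gt_eqF.
  rewrite ler_wpM2l ?divr_ge0 ?weight_ge0 //.
  apply: le_trans (ler_wpM2l (ltW u0) (hc n _)) _; first by rewrite un.
  by rewrite -natr_sum -natrM ler_nat sum_window_ge //; rewrite /N; lia.
have squares : \sum_(u <= y < X) (window b u N (y + u))%:R ^+ 2
    <= g%:R * u%:R ^+ 2 + u%:R * (count_below b N)%:R :> R.
  rewrite -!natrX -!natrM -natrD.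
  under eq_bigr do rewrite -natrX.
  rewrite -natr_sum ler_nat.
  apply: leq_trans (leq_trans (sum_window_sqr u N N hb) _); last first.
    by rewrite leq_add2l (leq_trans (sum_window_le _ _ _ _)) // minnn.
  have [uX|Xu] := leqP u X; last by rewrite big_geq //; lia.
  rewrite [leqRHS](big_cat_nat (n := (u + u)%N)) //=; last by rewrite /N; lia.
  by rewrite big_addn /N addnK leq_addl.
have mixed : \sum_(u <= y < X) 2 * weight R y * (window b u N (y + u))%:R <=
   2 / (c * u%:R) * \sum_(u <= y < X) (window b u N (y + u))%:R ^+ 2
   + c * u%:R / 2 * S.
  rewrite /S !big_distrr -big_split /= big_nat [leRHS]big_nat.
  apply: ler_sum => y /andP[uy _].
  rewrite -weight_sqr; last lia.
  set D := (window _ _ _ _)%:R; set w := weight _ _.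
  have cu : 0 < c * u%:R by rewrite mulr_gt0.
  (* The factor c u in the arithmetic-geometric mean inequality leaves exactly
     half of the main term u c S on the other side. *)
  have -> : 2 / (c * u%:R) * D ^+ 2 + c * u%:R / 2 * w ^+ 2 =
     2 * w * D + 2 / (c * u%:R) * (D - c * u%:R / 2 * w) ^+ 2.
    by field; rewrite !gt_eqF.
  by rewrite lerDl mulr_ge0 ?sqr_ge0 // divr_ge0 // ltW.
have total := le_trans lower (sum_window_weighted R b X N u1).
have cu : 0 < 2 / (c * u%:R) by rewrite divr_gt0 ?mulr_gt0.
have sq := ler_wpM2l (ltW cu) squares.
set W := weight R u in total *; set a2 := (count_below b (2 * u))%:R in total *.
set aN := (count_below b N)%:R in sq *.
have fin : u%:R * c * S <= 3 * W * (u%:R * a2)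
    + (2 / (c * u%:R) * (g%:R * u%:R ^+ 2 + u%:R * aN) + c * u%:R / 2 * S).
  lra.
(* Normalise by 2 c / u, and absorb c^2 S into the left side. *)
have t0 : 0 <= 2 * c / u%:R by rewrite divr_ge0 // ?mulr_ge0 // ltW.
have := ler_wpM2l t0 fin.
have -> : 2 * c / u%:R * (u%:R * c * S) = 2 * c ^+ 2 * S.
  by field; rewrite gt_eqF.
have -> : 2 * c / u%:R * (3 * W * (u%:R * a2) + (2 / (c * u%:R)
   * (g%:R * u%:R ^+ 2 + u%:R * aN) + c * u%:R / 2 * S))
  = 6 * c * (W * a2) + 4 * (g%:R + aN / u%:R) + c ^+ 2 * S.
  by field; rewrite !gt_eqF.
lra.
Qed.

Lemma count_below_le_sqrt (R : realType) g (b : pred nat) n :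
  (0 < g)%N -> (0 < n)%N -> sparse_differences g b ->
  (count_below b n)%:R <= Num.sqrt (8 * g%:R * n%:R) :> R.
Proof.
move=> g0 n0 hb.
rewrite -(@ger0_norm R (count_below b n)%:R) // -sqrtr_sqr.
rewrite ler_wsqrtr // -natrX -!natrM ler_nat.
have gn0 : (0 < g * n)%N by rewrite muln_gt0 g0.
have := count_below_sqr n hb; rewrite -mulnA.
by move: (count_below b n) (g * n)%N gn0 => a m m0; rewrite -mulnn; nia.
Qed.

Lemma ln_nat_unbounded (R : realType) (L : R) n0 :
  exists v : nat, [/\ (n0 <= v)%N, (1 < v)%N & L <= ln v%:R].
Proof.
have := archi_boundP (expR_ge0 L); set m := Num.bound _ => Lm.
exists (maxn (maxn n0 2) m); split; [lia|lia|].
rewrite -[L]expRK ler_ln ?posrE ?expR_gt0 ?ltr0n //; last lia.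
by apply: le_trans (ltW Lm) _; rewrite ler_nat; lia.
Qed.

(** The choice of u = K v and X = K v^2: the ratio of ln X to ln u tends to 2
    as v grows. *)
Lemma lnln_sub_ge (R : realType) (K v : nat) : (0 < K)%N -> (1 < v)%N ->
  ln 2 - ln K%:R / ln v%:R
  <= ln (ln (K * v ^ 2)%:R) - ln (ln (K * v)%:R) :> R.
Proof.
move=> K0 v1.
have l0 := ln_nat_gt0 R v1.
have k0 : 0 <= ln K%:R :> R by rewrite ln_ge0 // ler1n.
have -> : ln (K * v ^ 2)%:R = ln K%:R + 2 * ln v%:R :> R.
  rewrite natrM natrX lnM ?posrE ?exprn_gt0 ?ltr0n //; try lia.
  by rewrite lnXn ?ltr0n ?mulr_natl //; lia.
have -> : ln (K * v)%:R = ln K%:R + ln v%:R :> R.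
  by rewrite natrM lnM ?posrE ?ltr0n //; lia.
move: k0 l0; set k := ln K%:R; set l := ln v%:R => k0 l0.
have h : ln (2 * (k + l)) - ln (k + 2 * l) <= k / l.
  rewrite -ln_div ?posrE ?mulr_gt0 //; try by lra.
  have -> : 2 * (k + l) / (k + 2 * l) = 1 + k / (k + 2 * l).
    by field; rewrite gt_eqF //; lra.
  have kl : 0 < k + 2 * l by lra.
  have q0 : 0 <= k / (k + 2 * l) by rewrite divr_ge0 // ltW.
  apply: le_trans (le_ln1Dx _) _; first by lra.
  by rewrite ler_wpM2l // lef_pV2 ?posrE //; lra.
rewrite lnM ?posrE // in h; lra.
Qed.

(** * Choice of the parameters *)

Lemma sqrt_nat_le (R : realType) n : Num.sqrt n%:R <= n%:R :> R.
Proof.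
case: n => [|n]; first by rewrite sqrtr0.
by rewrite -[leRHS]ger0_norm // -sqrtr_sqr ler_wsqrtr // ler_eXnr // ler1n.
Qed.

Lemma sqrt_16M (R : realType) (x y : R) : 0 <= x ->
  Num.sqrt (4 ^+ 2 * x * y) = 4 * Num.sqrt x * Num.sqrt y.
Proof.
move=> x0; rewrite sqrtrM ?mulr_ge0 ?exprn_ge0 // sqrtrM ?exprn_ge0 //.
by rewrite sqrtr_sqr ger0_norm.
Qed.

(** The contribution of the windows with x < 2 u, for the window length u. *)
Lemma weight_count_below_le (R : realType) g (b : pred nat) u v :
  (0 < g)%N -> sparse_differences g b -> (1 < v <= u)%N ->
  weight R u * (count_below b (2 * u))%:R <= 4 * g%:R / Num.sqrt (ln v%:R).
Proof.
move=> g0 hb /andP[v1 vu].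
have u1 := leq_trans v1 vu.
have svl : 0 < Num.sqrt (ln v%:R) :> R by rewrite sqrtr_gt0 ln_nat_gt0.
have slu : 0 < Num.sqrt (ln u%:R) :> R by rewrite sqrtr_gt0 ln_nat_gt0.
have lvu : Num.sqrt (ln v%:R) <= Num.sqrt (ln u%:R) :> R.
  by rewrite ler_wsqrtr // ler_ln ?posrE ?ltr0n ?ler_nat //; lia.
have u20 : (0 < 2 * u)%N by lia.
have a_le := count_below_le_sqrt R g0 u20 hb.
apply: le_trans (ler_wpM2l (weight_ge0 R u) a_le) _.
have -> : 8 * g%:R * (2 * u)%:R = 4 ^+ 2 * g%:R * u%:R :> R.
  by rewrite natrM; ring.
have su : 0 < Num.sqrt u%:R :> R by rewrite sqrtr_gt0 ltr0n; lia.
rewrite sqrt_16M // /weight sqrtrM //.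
have -> : (Num.sqrt u%:R * Num.sqrt (ln u%:R))^-1
    * (4 * Num.sqrt g%:R * Num.sqrt u%:R)
    = 4 * Num.sqrt g%:R / Num.sqrt (ln u%:R) :> R.
  by field; rewrite !gt_eqF.
rewrite ler_pM ?mulr_ge0 ?invr_ge0 ?sqrtr_ge0 //.
  by rewrite ler_pM2l // sqrt_nat_le.
by rewrite lef_pV2.
Qed.

Lemma count_below_div_le (R : realType) g (b : pred nat) k v :
  (0 < g)%N -> sparse_differences g b -> (0 < k)%N -> (0 < v)%N ->
  (count_below b (k ^ 2 * v ^ 2 + k ^ 2 * v))%:R / (k ^ 2 * v)%:R
  <= 4 * g%:R / k%:R :> R.
Proof.
move=> g0 hb k0 v0.
have kR : 0 < k%:R :> R by rewrite ltr0n.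
have vR : 0 < v%:R :> R by rewrite ltr0n.
rewrite ler_pdivrMr ?ltr0n ?muln_gt0 ?expn_gt0 ?k0 //.
have -> : 4 * g%:R / k%:R * (k ^ 2 * v)%:R = 4 * g%:R * (k * v)%:R :> R.
  by rewrite !natrM; field; rewrite gt_eqF.
have n0 : (0 < k ^ 2 * v ^ 2 + k ^ 2 * v)%N.
  by rewrite ltn_addl // muln_gt0 expn_gt0 k0.
apply: le_trans (count_below_le_sqrt R g0 n0 hb) _.
apply: (@le_trans _ _ (Num.sqrt ((4 ^+ 2) * g%:R * (k * v)%:R ^+ 2))).
  rewrite ler_wsqrtr // -!natrX -!natrM ler_nat.
  have : (v <= v * v)%N by rewrite leq_pmull.
  move/(leq_mul (leqnn (g * (k * k)))).
  rewrite -!mulnn; lia.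
rewrite sqrt_16M // sqrtr_sqr ger0_norm //.
by rewrite ler_wpM2r // ler_wpM2l // sqrt_nat_le.
Qed.

(** A lower bound of the order sqrt(n / ln n) for the counting function has
    constant c at most 2 sqrt(g / ln 2). *)
Lemma eventual_lower_bound_le (R : realType) (g : nat) (b : pred nat)
    (c : R) (n0 : nat) :
  (0 < g)%N -> sparse_differences g b -> 0 < c ->
  (forall n, (n0 <= n)%N ->
     c * Num.sqrt (n%:R / ln n%:R) <= (count_below b n)%:R) ->
  c ^+ 2 * ln 2 <= 4 * g%:R.
Proof.
move=> g0 hb c0 hc; rewrite leNgt; apply/negP => eta0.
(* Each of the three error terms is made at most a quarter of this excess. *)
pose eta := c ^+ 2 * ln 2 - 4 * g%:R.
have {}eta0 : 0 < eta by rewrite subr_gt0.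
have [k k0 kb] : exists2 k, (0 < k)%N & 64 * g%:R / eta < k%:R.
  have : 0 <= 64 * g%:R / eta by rewrite divr_ge0 ?mulr_ge0 // ltW.
  move=> /archi_boundP; set m := Num.bound _ => gm.
  by exists m.+1 => //; apply: lt_trans gm _; rewrite ltr_nat.
have kR : 0 < k%:R :> R by rewrite ltr0n.
(* L1 controls the windows with x < 2 u, L2 the defect of S from ln 2. *)
pose L1 : R := (96 * c * g%:R / eta) ^+ 2.
pose L2 : R := 4 * c ^+ 2 * ln (k ^ 2)%:R / eta.
have [v [vn0 v1 vL]] := ln_nat_unbounded (Num.max L1 L2) n0.
have l0 := ln_nat_gt0 R v1.
have K0 : (0 < k ^ 2)%N by rewrite expn_gt0 k0.
have vu : (v <= k ^ 2 * v)%N by rewrite leq_pmull.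
have u1 := leq_trans v1 vu.
have uX : (k ^ 2 * v <= k ^ 2 * v ^ 2)%N.
  by rewrite leq_mul2l leq_pmulr ?orbT // ltnW.
have hcX n : (k ^ 2 * v <= n < k ^ 2 * v ^ 2)%N ->
    c * Num.sqrt (n%:R / ln n%:R) <= (count_below b n)%:R.
  by move=> /andP[un _]; apply: hc; rewrite (leq_trans vn0) ?(leq_trans vu).
have main := weighted_window_bound hb c0 u1 hcX.
have S_ge := le_trans (lnln_sub_ge R K0 v1)
  (sum_inv_nln_ge R (introT andP (conj u1 uX))).
have {S_ge main} := le_trans (ler_wpM2l (sqr_ge0 c) S_ge) main.
have t1 : 6 * c * (weight R (k ^ 2 * v) * (count_below b (2 * (k ^ 2 * v)))%:R)
    <= eta / 4.
  apply: (@le_trans _ _ (6 * c * (4 * g%:R / Num.sqrt (ln v%:R)))).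
    by rewrite ler_wpM2l ?mulr_ge0 ?weight_count_below_le ?v1 // ltW.
  have : 96 * c * g%:R / eta <= Num.sqrt (ln v%:R).
    rewrite -[leLHS]ger0_norm -?sqrtr_sqr.
      by rewrite ler_wsqrtr // (le_trans _ vL) // le_max lexx.
    by rewrite divr_ge0 ?mulr_ge0 // ltW.
  rewrite ler_pdivrMr // => h1.
  by rewrite mulrA ler_pdivrMr ?sqrtr_gt0 //; lra.
have t2 : c ^+ 2 * (ln (k ^ 2)%:R / ln v%:R) <= eta / 4.
  have : L2 <= ln v%:R by rewrite (le_trans _ vL) // le_max lexx orbT.
  rewrite /L2 ler_pdivrMr // => h.
  by rewrite mulrA ler_pdivrMr //; lra.
have t3 : 4 * ((count_below b (k ^ 2 * v ^ 2 + k ^ 2 * v))%:R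
    / (k ^ 2 * v)%:R) <= eta / 4.
  have a_le := count_below_div_le R g0 hb k0 (ltnW v1).
  apply: le_trans (ler_wpM2l _ a_le) _ => //.
  move: kb; rewrite ltr_pdivrMr // => kb.
  by rewrite mulrA ler_pdivrMr //; lra.
by rewrite mulrBr mulrDr; rewrite /eta in t1 t2 t3 eta0; lra.
Qed.

(** * From sets to predicates, and the lower limit *)

Lemma countingE (A : set nat) n : counting A n = count_below (mem A) n.
Proof.
rewrite /counting /count_below.
have -> : A `&` `I_n = [set` [fset a in [seq a <- iota 0 n | a \in A]]%fset].
  apply/seteqP; split => a /=; rewrite !inE /= mem_filter mem_iota /=.
    by move=> [/mem_set -> ->].
  by move=> /andP[/set_mem Aa an].
rewrite set_fsetK card_fseq undup_id ?filter_uniq ?iota_uniq //.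
rewrite size_filter -sum1_count big_mkcond /= /index_iota subn0.
by apply: eq_bigr => a _; case: (a \in A).
Qed.

Lemma golomb_sparse_differences g (A : set nat) :
  golomb_ruler g A -> sparse_differences g (mem A).
Proof.
move=> hA d N d0.
set s := [seq a <- iota 0 N | (a \in A) && (a + d \in A)%N].
have -> : (\sum_(0 <= a < N) mem A a * mem A (a + d) = size s)%N.
  rewrite size_filter -sum1_count [RHS]big_mkcond /= /index_iota subn0.
  apply: eq_bigr => a _.
  by rewrite /=; case: (a \in A); case: (_ \in A).
have us : uniq s by rewrite filter_uniq ?iota_uniq.
have inj : injective (fun a : nat => (a + d, a)%N) by move=> x y [].
pose S := [fset p in [seq (a + d, a)%N | a <- s]]%fset.
have <- : #|` S|%fset = size s.
  by rewrite card_fseq undup_id ?size_map ?map_inj_uniq.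
rewrite -card_le_II.
have /card_eq_fsetP SE := erefl #|` S|%fset.
rewrite -(card_le_eql SE).
apply: card_le_trans (hA d%:Z _); last by lia.
apply: subset_card_le => p /=; rewrite !inE /= => /mapP[a].
rewrite mem_filter => /andP[/andP[/set_mem ha /set_mem hb] _] -> /=.
by split => //; lia.
Qed.

Lemma lt_limn_einf (R : realType) (f : nat -> R) (B : R) :
  (B%:E < limn_einf (fun n => (f n)%:E))%E ->
  exists c n0, B < c /\ forall n, (n0 <= n)%N -> c <= f n.
Proof.
rewrite limn_einf_lim.
have /cvg_lim -> // := ereal_nondecreasing_cvgn
  (nondecreasing_einfs (fun n => (f n)%:E)).
move=> /ereal_sup_gt[_ [n0 _ <-]] Be.
have {}Be : (B%:E < ereal_inf (sdrop (fun n => (f n)%:E) n0))%E := Be.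
have le_f n : (n0 <= n)%N ->
    (ereal_inf (sdrop (fun n => (f n)%:E) n0) <= (f n)%:E)%E.
  by move=> nn; apply: ereal_inf_lbound; exists n.
move: Be le_f; case: ereal_inf => [r| |] // Be le_f.
- exists r, n0; split; first by rewrite -lte_fin.
  by move=> n /le_f; rewrite lee_fin.
- by have := le_f n0 (leqnn n0); rewrite leye_eq.
Qed.

Theorem theorem1 (R : realType) (g : nat) (hg : (0 < g)%N) (A : set nat)
    (hA : golomb_ruler g A) :
  (limn_einf (fun n : nat =>
     ((counting A n)%:R / Num.sqrt (n%:R / ln n%:R))%:E : \bar R)
   <= (2 / Num.sqrt (ln 2) * Num.sqrt g%:R)%:E)%E.
Proof.
rewrite leNgt; apply/negP => /lt_limn_einf[c [n0 [Bc cle]]].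
have l2 : 0 < ln 2 :> R by rewrite ln_gt0 // ltr1n.
set B := _ * _ in Bc.
have B0 : 0 <= B by rewrite mulr_ge0 ?divr_ge0 ?sqrtr_ge0.
have Bsq : B ^+ 2 * ln 2 = 4 * g%:R.
  rewrite /B exprMn expr_div_n !sqr_sqrtr ?(ltW l2) //.
  by field; rewrite gt_eqF.
have c0 : 0 < c by rewrite (le_lt_trans B0).
suff : c ^+ 2 * ln 2 <= B ^+ 2 * ln 2.
  by rewrite ler_pM2r // ler_pXn2r ?nnegrE ?(ltW c0) // leNgt Bc.
rewrite Bsq.
apply: (@eventual_lower_bound_le _ _ (mem A) _ (maxn n0 2)) => //.
  exact: golomb_sparse_differences.
move=> n; rewrite geq_max => /andP[n0n n2].
rewrite -countingE -ler_pdivlMr ?cle //.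
by rewrite sqrtr_gt0 divr_gt0 ?ln_nat_gt0 // ltr0n; lia.
Qed.
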